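(* Let $X$ be a set and let $C\subseteq\{0,1\}^X$ be a nonempty finite $(3,6)$ concept class. Then there exists some $c\in C$ with a teaching set in $C$ of size at most $3$.
   Context: A concept class over a set $X$ is a set $C\subseteq\{0,1\}^X$ of functions $X\to\{0,1\}$. For $Y\subseteq X$, $C|_Y=\{c|_Y:c\in C\}$. The class $C$ is called a $(3,6)$ concept class if for every three distinct elements $x,y,z\in X$ the projection $C|_{\{x,y,z\}}$ has at most $6$ elements. A set $Y\subseteq X$ is a teaching set for $c\in C$ in $C$ if for every $c'\in C$ with $c'\neq c$ we have $c'|_Y\neq c|_Y$. *)

(* Defs.v *)
From mathcomp Require Import all_boot.
From mathcomp Require Import boolp classical_sets functions cardinality.

Local Open Scope classical_set_scope.
Local Open Scope card_scope.

Definition concept_class (X : Type) : Type := set (X -> bool).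

(* The restriction is an actual function on the subtype of elements of [Y], so
   equality of restrictions is equality of functions [Y -> bool]. *)
Definition restriction {X : Type} (Y : set X) (c : X -> bool) : Y -> bool :=
  fun y => c (set_val y).

Definition projection {X : Type} (C : concept_class X) (Y : set X) :
    concept_class Y :=
  restriction Y @` C.

(* [A #<= `I_n] says that [A] injects into {0, ..., n-1}, i.e. that [A] is
   finite with at most n elements. *)
Definition concept_class_3_6 {X : Type} (C : concept_class X) : Prop :=
  forall x y z : X, x <> y -> x <> z -> y <> z ->
    projection C [set x; y; z] #<= `I_6.

Definition teaching_set {X : Type} (C : concept_class X) (c : X -> bool)
    (Y : set X) : Prop :=
  forall c' : X -> bool, C c' -> c' <> c ->
    restriction Y c' <> restriction Y c.

(* Main.v *)
(* Let D = {x = b} be an inclusion-minimal nonempty half of C, and let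
   E = {y = p, z = q} be an inclusion-minimal nonempty quarter contained in D.
   If E shatters no pair of points, then minimality gives some c in E and a point
   w that teaches c within E, so {y, z, w} teaches c in C.

   Suppose E shatters u, v. The (3,6) condition leaves at most two (u, v)-patterns
   on each of {y <> p}, {z <> q} and {x <> b}. Minimality of E forbids u or v to be
   constant on {y <> p} or {z <> q}, so u (+) v is constant there, and the two
   constants differ, for otherwise {u = s, v = t} would be a smaller quarter for
   suitable s, t. Minimality of D makes both sets meet {x <> b}, so u (+) v is not
   constant on {x <> b}; hence u or v is constant there, which yields a half
   strictly inside D. *)

Require Import Defs.
From mathcomp Require Import all_boot.
From mathcomp Require Import finmap.
From mathcomp Require Import boolp classical_sets functions cardinality.

Local Open Scope classical_set_scope.
Local Open Scope card_scope.

Lemma finite_minimal_set {T : Type} (C : set T) (P : set (set T)) (A0 : set T) :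
  finite_set C -> (forall A, P A -> A `<=` C) -> P A0 ->
  exists2 A, P A & forall B, P B -> B `<=` A -> A `<=` B.
Proof.
elim/Pchoice: T => T in C P A0 * => Cfin PC.
have Pfin A : P A -> finite_set A.
  by move=> /PC sAC; exact: sub_finite_set sAC Cfin.
have [n] := ubnP #|` fset_set A0|; elim: n A0 => // n IHn A0 A0n PA0.
have [Amin|/existsNP[B /not_implyP[PB /not_implyP[BA AB]]]] :=
  pselect (forall B, P B -> B `<=` A0 -> A0 `<=` B); first by exists A0.
apply: (IHn B) => //; rewrite -ltnS; apply: leq_trans A0n; rewrite ltnS.
apply: fproper_ltn_card; rewrite fproperE; apply/andP; split.
  by rewrite -fset_set_sub //; exact: Pfin.
by apply/negP; rewrite -fset_set_sub //; exact: Pfin.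
Qed.

(** A half is a [cut] and a quarter is a [cut] of a [cut]; the two cutting points may coincide. *)
Definition cut {X : Type} (C : concept_class X) (x : X) (b : bool) :
  concept_class X := [set c | C c /\ c x = b].

Definition shatters {X : Type} (C : concept_class X) (x y : X) : Prop :=
  forall p q : bool, exists2 c, C c & c x = p /\ c y = q.

Lemma minimal_half {X : Type} (C : concept_class X) (x0 : X) :
  C !=set0 -> finite_set C ->
  exists x b, cut C x b !=set0 /\
    forall y d, cut C y d !=set0 -> cut C y d `<=` cut C x b ->
      cut C x b `<=` cut C y d.
Proof.
move=> [c0 Cc0] Cfin.
pose halves := [set A | A !=set0 /\ exists x b, A = cut C x b].
have [||A [A0 [x [b AE]]] Amin] :=
  @finite_minimal_set _ C halves (cut C x0 (c0 x0)) Cfin.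
- by move=> _ [_ [x [b ->]]] c [].
- by split; [exists c0 | exists x0, (c0 x0)].
rewrite AE in A0 Amin; exists x, b; split=> // y d yd; apply: Amin.
by split=> //; exists y, d.
Qed.

(* In an inclusion-minimal nonempty half of [C], two concepts differing at [y]
   would force, for some value [q], the half [y = q] to be nonempty and strictly
   smaller. *)
Lemma unshattered_teaching_point {X : Type} (C : concept_class X) (x0 : X) :
  C !=set0 -> finite_set C -> (forall x y, ~ shatters C x y) ->
  exists2 c, C c & exists x, forall c', C c' -> c' x = c x -> c' = c.
Proof.
move=> C0 Cfin unsh.
have [x [b [[c [Cc cx]] Hmin]]] := minimal_half C x0 C0 Cfin.
exists c => //; exists x => c' Cc' c'x; rewrite cx in c'x.
apply: contrapT => c'Nc.
have [y yN] : exists y, c' y <> c y.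
  by apply/existsNP => e; apply: c'Nc; apply/funext.
have both q : exists2 e, cut C x b e & e y = q.
  have [<-|Nq] := eqVneq (c y) q; first by exists c.
  by exists c' => //; move: yN Nq; case: (c y) (c' y) q => [] [] [].
(* By [both], a missing pattern [(p, q)] has [p = ~~ b]. Then the half [y = q] lies inside [x = b]
   but omits [e'], against minimality. *)
apply: (unsh x y) => p q; apply: contrapT => npq.
have [e [Ce ex] ey] := both q.
have pb : p <> b by move=> pb; case: npq; exists e; rewrite ?pb.
have [e' e'xb e'y] := both (~~ q).
have [||_ e'q] := Hmin y q _ _ e' e'xb.
- by exists e.
- move=> f [Cf fy]; split=> //; apply: contrapT => fx; apply: npq; exists f => //.
  by split=> //; move: pb fx; case: (f x) (p) (b) => [] [] [].
by move: e'y; rewrite e'q; case: (q).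
Qed.

Lemma card_le_set3 {X : Type} (x y z : X) : [set x; y; z] #<= `I_3.
Proof.
pose f n := if n is n'.+1 then if n' is _.+1 then z else y else x.
apply: card_le_trans (card_image_le f _); apply: subset_card_le => t /=.
by case=> [[]|] ->; [exists 0%N | exists 1%N | exists 2%N].
Qed.

(** Evaluation at the three points carries the bound from restrictions to triples of booleans, where
    patterns can be counted by listing them. *)
Lemma concept_class_3_6_patterns {X : Type} (C : concept_class X) (x y z : X)
    (s : seq (bool * bool * bool)) :
  concept_class_3_6 C -> x <> y -> x <> z -> y <> z -> uniq s ->
  (forall p, p \in s -> exists2 c, C c & (c x, c y, c z) = p) ->
  (size s <= 6)%N.
Proof.
move=> C36 xy xz yz us sC; have le6 := C36 x y z xy xz yz.
set Y := [set x; y; z] in le6.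
have Yx : x \in Y by rewrite inE; left; left.
have Yy : y \in Y by rewrite inE; left; right.
have Yz : z \in Y by rewrite inE; right.
pose g (f : Y -> bool) := (f (SigSub Yx), f (SigSub Yy), f (SigSub Yz)).
have le6' := card_le_trans (card_image_le g _) le6.
apply: leq_trans (geq_card_fset_set le6'); apply: uniq_leq_size => // p ps.
rewrite in_fset_set; last exact: card_le_finite le6' (finite_II 6).
rewrite inE; have [c Cc cp] := sC p ps.
by exists (restriction Y c) => //; exists c.
Qed.

(* At most two of the four patterns survive on the opposite half, and a set of
   at most two patterns lies in one of the six pairs of points of the square. *)
Lemma opposite_half_patterns {X : Type} (C : concept_class X) (x u v : X)
    (b : bool) :
  concept_class_3_6 C -> shatters (cut C x b) u v ->
  [\/ exists d, forall c, C c -> c x <> b -> c u = d,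
      exists d, forall c, C c -> c x <> b -> c v = d |
      exists d, forall c, C c -> c x <> b -> c u (+) c v = d].
Proof.
move=> C36 sh.
have xu : x <> u.
  move=> xu; have [c [_ cx] [cu _]] := sh (~~ b) b.
  by move: cu; rewrite -xu cx; case: (b).
have xv : x <> v.
  move=> xv; have [c [_ cx] [_ cv]] := sh b (~~ b).
  by move: cv; rewrite -xv cx; case: (b).
have uv : u <> v by move=> uv; have [c _ [cu]] := sh true false; rewrite -uv cu.
pose r (p : bool * bool) :=
  `[< exists2 c, C c & (c x, c u, c v) = (~~ b, p.1, p.2) >].
have rC c : C c -> c x <> b -> r (c u, c v).
  by move=> Cc cx; apply/asboolP; exists c => //=; move: cx; case: (c x) (b) => [] [].
have le2 s : uniq s -> all r s ==> (size s <= 2)%N.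
  move=> us; apply/implyP => rs.
  (* The shattered pair already uses four triples starting with [b]; of the six allowed, only two
     remain for [~~ b]. *)
  pose sq := [:: (true, true); (true, false); (false, true); (false, false)].
  rewrite -(leq_add2l 4) -[4]/(size [seq (b, p.1, p.2) | p <- sq]).
  rewrite -(size_map (fun p => (~~ b, p.1, p.2)) s) -size_cat.
  apply: (concept_class_3_6_patterns C x u v) => //.
    have inj d : injective (fun p : bool * bool => (d, p.1, p.2)).
      by move=> [? ?] [? ?] [-> ->].
    rewrite cat_uniq !map_inj_uniq ?us //= andbT; apply/hasPn => _ /mapP[p _ ->].
    by rewrite /= !inE !xpair_eqE; case: (b).
  move=> p; rewrite mem_cat => /orP[] /mapP[q qs ->] /=.
    by have [c [Cc cx] [cu cv]] := sh q.1 q.2; exists c => //; rewrite cx cu cv.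
  by have /asboolP := allP rs q qs.
have excl p : ~~ r p -> forall c, C c -> c x <> b -> (c u, c v) != p.
  by move=> /negP np c Cc cx; apply/eqP => cp; apply: np; rewrite -cp; exact: rC.
(* Absence of the first two pairs fixes [u], of the next two [v], of the last two [u (+) v]. *)
have : [|| ~~ r (true, true) && ~~ r (true, false),
    ~~ r (false, true) && ~~ r (false, false),
    ~~ r (true, true) && ~~ r (false, true) |
    [|| ~~ r (true, false) && ~~ r (false, false),
        ~~ r (true, false) && ~~ r (false, true) |
        ~~ r (true, true) && ~~ r (false, false)]].
  move: (le2 [:: (true, true); (true, false); (false, true)] isT)
        (le2 [:: (true, true); (true, false); (false, false)] isT)
        (le2 [:: (true, true); (false, true); (false, false)] isT)
        (le2 [:: (true, false); (false, true); (false, false)] isT) => /=.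
  by case: (r (true, true)); case: (r (true, false));
     case: (r (false, true)); case: (r (false, false)).
case/or4P => [|||/or3P[]] /andP[/excl e1 /excl e2];
  [apply: Or31; exists false | apply: Or31; exists true |
   apply: Or32; exists false | apply: Or32; exists true |
   apply: Or33; exists false | apply: Or33; exists true] => c Cc cx;
  by move: (e1 c Cc cx) (e2 c Cc cx); case: (c u); case: (c v).
Qed.

Lemma unshattered_quarter {X : Type} (C : concept_class X) (x0 : X) :
  C !=set0 -> finite_set C -> concept_class_3_6 C ->
  exists y p z q, cut (cut C y p) z q !=set0 /\
    forall u v, ~ shatters (cut (cut C y p) z q) u v.
Proof.
move=> C0 Cfin C36.
have [x [b [D0 Dmin]]] := minimal_half C x0 C0 Cfin.
set D := cut C x b in D0 Dmin.
pose quarters := [set A | [/\ A !=set0, A `<=` D &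
  exists y p z q, A = cut (cut C y p) z q]].
have [E [E0 ED [y [p [z [q EE]]]]] Emin] :
    exists2 A, quarters A & forall B, quarters B -> B `<=` A -> A `<=` B.
  apply: (@finite_minimal_set _ C quarters D Cfin).
    by move=> A [_ AD _] c /AD[].
  (* [D] is itself a quarter, cut twice at [x]. *)
  split=> //; exists x, b, x, b; apply/seteqP.
  by split=> c; [move=> Dc; split=> //; case: Dc | case].
exists y, p, z, q; rewrite -EE; split=> // u v sh.
have EP c : E c <-> [/\ C c, c y = p & c z = q].
  by rewrite EE; split=> [[[]]|[]].
have EC c : E c -> C c by case/EP.
have notb (r s : bool) : r <> s -> r = ~~ s by case: r s => [] [].
have Eu d : exists2 c, E c & c u = d by have [c Ec []] := sh d d; exists c.
have Ev d : exists2 c, E c & c v = d by have [c Ec []] := sh d d; exists c.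
(* A quarter inside [E] that meets [E] is all of [E] by minimality. *)
have Equarter w r w' r' : (exists2 c, E c & c w = r /\ c w' = r') ->
    (forall c, C c -> c w = r -> c w' = r' -> E c) ->
    forall c, E c -> c w = r.
  move=> [e Ee [ew ew']] sub c Ec.
  have [||[] //] := Emin (cut (cut C w r) w' r') _ _ c Ec.
    split; first by exists e; split=> //; split=> //; exact: EC.
      by move=> f [[Cf fw] fw']; apply: ED; exact: sub.
    by exists w, r, w', r'.
  by move=> f [[Cf fw] fw']; exact: sub.
have Dhalf w d : (forall d, exists2 c, E c & c w = d) ->
    ~ (forall c, C c -> c x <> b -> c w = d).
  move=> Ew cst; have [e Ee ew] := Ew (~~ d); have [f Ef fw] := Ew d.
  have [||_] := Dmin w (~~ d) _ _ f (ED f Ef); last by rewrite fw; case: (d).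
    by exists e; split=> //; exact: EC.
  move=> g [Cg gw]; split=> //; apply: contrapT => /(cst g Cg).
  by rewrite gw; case: (d).
(* The description of [E] is a parameter so that [y] and [z] can be exchanged. If [w] were [d] off
   [y' = p'], the quarter [w = ~~ d], [z' = q'] would lie in [E]. *)
have nconst w d y' p' z' q' : (forall c, E c <-> [/\ C c, c y' = p' & c z' = q']) ->
    (forall d, exists2 c, E c & c w = d) ->
    ~ (forall c, C c -> c y' <> p' -> c w = d).
  move=> EP' Ew cst; have [e Ee ew] := Ew (~~ d); have [f Ef fw] := Ew d.
  suff : f w = ~~ d by rewrite fw; case: (d).
  apply: (Equarter w (~~ d) z' q') => //; first by exists e => //; case/EP': Ee.
  move=> g Cg gw gz; apply/EP'; split=> //; apply: contrapT => /(cst g Cg).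
  by rewrite gw; case: (d).
have xor y' p' z' q' : (forall c, E c <-> [/\ C c, c y' = p' & c z' = q']) ->
    exists d, forall c, C c -> c y' <> p' -> c u (+) c v = d.
  move=> EP'; have sh' : shatters (cut C y' p') u v.
    by move=> s t; have [c /EP'[Cc cy _] cuv] := sh s t; exists c.
  have [[d cst]|[d cst]|//] := opposite_half_patterns C y' u v p' C36 sh'.
    by case: (nconst u d y' p' z' q' EP' Eu cst).
  by case: (nconst v d y' p' z' q' EP' Ev cst).
have EP' c : E c <-> [/\ C c, c z = q & c y = p].
  by split=> [/EP[? ? ?]|[? ? ?]]; [|apply/EP].
have [dy xory] := xor y p z q EP.
have [dz xorz] := xor z q y p EP'.
have dyz d : (forall c, C c -> c y <> p -> c u (+) c v = d) ->
    ~ (forall c, C c -> c z <> q -> c u (+) c v = d).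
  (* On [u = true], [v = d] the sum is [~~ d], which forces both [y = p] and [z = q]. *)
  move=> hy hz; have [e Ee euv] := sh true d; have [f Ef [fu _]] := sh false d.
  suff : f u = true by rewrite fu.
  apply: (Equarter u true v d) => //.
  move=> g Cg gu gv; apply/EP; split=> //; apply: contrapT.
    by move=> /(hy g Cg); rewrite gu gv; case: (d).
  by move=> /(hz g Cg); rewrite gu gv; case: (d).
(* Otherwise the half [w = ~~ r] would lie in [D] and miss [E]. *)
have out w r : (forall c, E c -> c w = r) -> (exists2 c, C c & c w <> r) ->
    exists c, [/\ C c, c w <> r & c x <> b].
  move=> Ew [c Cc cw]; apply: contrapT => nout.
  have [e Ee] := E0.
  have [||_] := Dmin w (~~ r) _ _ e (ED e Ee); last by rewrite Ew //; case: (r).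
    by exists c; split=> //; exact: notb.
  move=> g [Cg gw]; split=> //; apply: contrapT => gx; apply: nout; exists g.
  by split=> //; rewrite gw; case: (r).
(* If [y = p] throughout [C], every constant works vacuously off [y = p], in particular [dz]. *)
have ney : exists2 c, C c & c y <> p.
  apply: contrapT => no; apply: (dyz dz) => // c Cc cy.
  by case: no; exists c.
have nez : exists2 c, C c & c z <> q.
  apply: contrapT => no; apply: (dyz dy) => // c Cc cz.
  by case: no; exists c.
have [|c [Cc cy cx]] := out y p _ ney; first by move=> f /EP[].
have [|e [Ce ez ex]] := out z q _ nez; first by move=> f /EP[].
have shx : shatters (cut C x b) u v.
  by move=> s t; have [f Ef fuv] := sh s t; exists f => //; exact: ED.
have [[d cst]|[d cst]|[d cst]] := opposite_half_patterns C x u v b C36 shx.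
- exact: Dhalf Eu cst.
- exact: Dhalf Ev cst.
(* The witnesses [c] and [e] outside [D] show [dy = d] and [dz = d]. *)
apply: (dyz d) => f Cf ff.
  by rewrite (xory f) // -(xory c) // cst.
by rewrite (xorz f) // -(xorz e) // cst.
Qed.

Theorem lemma1p7 (X : Type) (C : concept_class X) :
  C !=set0 -> finite_set C -> concept_class_3_6 C ->
  exists c : X -> bool, C c /\
    exists Y : set X, teaching_set C c Y /\ Y #<= `I_3.
Proof.
move=> C0 Cfin C36; have [c0 Cc0] := C0.
have [[x0]|noX] := pselect (inhabited X); last first.
  (* Over an empty [X] there is only one concept. *)
  exists c0; split=> //; exists set0; split; last exact: card_ge0.
  by move=> c _ []; apply/funext => x; case: noX.
have [y [p [z [q [E0 unsh]]]]] := unshattered_quarter C x0 C0 Cfin C36.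
have Efin : finite_set (cut (cut C y p) z q).
  by apply: sub_finite_set Cfin => c [[]].
have [c [[Cc cy] cz] [w wc]] := unshattered_teaching_point _ x0 E0 Efin unsh.
exists c; split=> //; exists [set y; z; w]; split; last exact: card_le_set3.
(* Agreement at [y] and [z] puts [c'] in the quarter, where [w] singles out [c]. *)
move=> c' Cc' c'Nc eqY; apply: c'Nc.
have agree t : [set y; z; w] t -> c' t = c t.
  by move=> /mem_set Yt; exact: (congr1 (fun f => f (SigSub Yt)) eqY).
have [c'y c'z c'w] : [/\ c' y = c y, c' z = c z & c' w = c w].
  by split; apply: agree; [left; left | left; right | right].
by apply: wc => //; split; [split|]; rewrite ?c'y ?c'z.
Qed.
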